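(* Let $\mathcal C\le\mathbb F_q^{n\times m}$ be a rank-metric code of dimension $k$ with associated rank function $\rho_{\mathcal C}$. (1) For every integer $0\le r\le k$ and every subspace $W\le E$, $$A^{(r)}_{\mathcal C}(W)=\sum_{J\le W}\mu(J,W)\begin{bmatrix}\rho_{\mathcal C}(E)-\rho_{\mathcal C}(J^\perp)\\ r\end{bmatrix}_q,$$ where $\mu(K,J)=(-1)^{\dim J-\dim K}q^{\binom{\dim J-\dim K}{2}}$ if $K\le J$ and $\mu(K,J)=0$ otherwise. In particular $\rho_{\mathcal C}$ determines the whole family $\{A^{(r)}_{\mathcal C}\}_{r=0}^k$. (2) Conversely, for every $J\le E$, $$\rho_{\mathcal C}(J)=\dim\mathcal C-\log_q\Bigl(1+(q-1)\sum_{W\le J^\perp}A^{(1)}_{\mathcal C}(W)\Bigr),$$ so $A^{(1)}_{\mathcal C}$ determines $\rho_{\mathcal C}$ uniquely. Consequently, the $(q,m)$-polymatroid $P_{\mathcal C}$ and the family $\{A^{(r)}_{\mathcal C}\}_{r=0}^{k}$ determine each other.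
   Context: $q$ prime power, $E=\mathbb F_q^n$, $\mathcal L(E)$ its subspaces. A rank-metric code is an $\mathbb F_q$-subspace $\mathcal C\le\mathbb F_q^{n\times m}$. For $M\in\mathcal C$, $\mathrm{supp}(M)$ is its column space; for a subcode $\mathcal D\le\mathcal C$, $\mathrm{Supp}(\mathcal D)=\sum_{M\in\mathcal D}\mathrm{supp}(M)$. For $J\le E$, $\mathcal C(J)=\{M\in\mathcal C\mid\mathrm{supp}(M)\subseteq J\}$, $J^\perp$ is the orthogonal complement for the standard dot product, and $\rho_{\mathcal C}(J)=\dim\mathcal C-\dim\mathcal C(J^\perp)$; $P_{\mathcal C}=(E,\rho_{\mathcal C})$. The $r$-th higher support distribution is $A^{(r)}_{\mathcal C}(W)=|\{\mathcal D\le\mathcal C\mid \dim\mathcal D=r,\ \mathrm{Supp}(\mathcal D)=W\}|$ for $W\le E$. The Gaussian coefficient is $\begin{bmatrix}a\\ b\end{bmatrix}_q=\prod_{i=0}^{b-1}\frac{q^{a-i}-1}{q^{b-i}-1}$ for $a\in\mathbb Z$, $b\in\mathbb Z_{\ge0}$ (and $0$ for $b<0$). *)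

(* Defs.v *)
From HB Require Import structures.
From mathcomp Require Import all_boot all_order all_algebra.
From mathcomp Require Import sesquilinear zify.
From mathcomp Require Import reals exp.

Set Implicit Arguments.
Unset Strict Implicit.
Unset Printing Implicit Defensive.

Import Order.TTheory GRing.Theory Num.Theory.
Local Open Scope ring_scope.

Section FiniteVspace.
Variables (F : finFieldType) (vT : vectType F).

HB.instance Definition _ :=
  CanIsCountable (@VectorInternalTheory.vs2mxK F vT).
HB.instance Definition _ : isFinite {vspace vT} :=
  CanIsFinite (@VectorInternalTheory.vs2mxK F vT).

End FiniteVspace.

Section DotProduct.
Variables (F : fieldType) (n : nat).
Implicit Types (u v : 'cV[F]_n) (J : {vspace 'cV[F]_n}).

Definition dot u v : F := \sum_i u i 0 * v i 0.

Let dotC u v : dot u v = dot v u.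
Proof. by apply: eq_bigr => i _; rewrite mulrC. Qed.

Let dotB v : zmod_morphism (dot^~ v).
Proof.
by move=> x y; rewrite /dot -sumrB; apply: eq_bigr => i _; rewrite !mxE mulrBl.
Qed.

Let dotZ v : scalable_for *%R (dot^~ v).
Proof.
by move=> a x; rewrite /dot mulr_sumr; apply: eq_bigr => i _; rewrite mxE mulrA.
Qed.

Let dotBr u : zmod_morphism (dot u).
Proof. by move=> x y; rewrite dotC dotB !(dotC u). Qed.

Let dotZr u : scalable_for (idfun \; *%R) (dot u).
Proof. by move=> a x; rewrite dotC dotZ (dotC u). Qed.

Let dot_herm u v : dot u v = (-1) ^+ false * idfun (dot v u).
Proof. by rewrite expr0 mul1r dotC. Qed.

HB.instance Definition _ :=
  isBilinear.Build F 'cV[F]_n 'cV[F]_n F *%R (idfun \; *%R) dot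
    dotB dotBr dotZ dotZr.
HB.instance Definition _ :=
  isHermitianSesquilinear.Build F 'cV[F]_n false idfun dot dot_herm.

Definition perp J : {vspace 'cV[F]_n} :=
  orthov (dot : {hermitian 'cV[F]_n for false & idfun}) J.

Lemma mem_perpP J u : reflect {in J, forall v, dot u v = 0} (u \in perp J).
Proof. exact: mem_orthovP. Qed.

End DotProduct.

Section RankMetricCode.
Variables (F : finFieldType) (n m : nat).
Implicit Types (C D : {vspace 'M[F]_(n, m)}) (J K W : {vspace 'cV[F]_n}).

Definition supp (M : 'M[F]_(n, m)) : {vspace 'cV[F]_n} :=
  <<[seq col j M | j : 'I_m]>>%VS.

Definition Supp D : {vspace 'cV[F]_n} := (\sum_(M in D) supp M)%VS.

(* The span adds no element: see mem_shorten. *)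
Definition shorten C J : {vspace 'M[F]_(n, m)} :=
  <<enum [set M in C | (supp M <= J)%VS]>>%VS.

Lemma supp_subP (M : 'M[F]_(n, m)) J :
  reflect (forall j, col j M \in J) (supp M <= J)%VS.
Proof.
apply: (iffP span_subvP) => [sMJ j | sMJ _ /mapP[j _ ->] //].
by apply: sMJ; apply: map_f; rewrite mem_enum.
Qed.

Lemma mem_shorten C J M :
  (M \in shorten C J) = (M \in C) && (supp M <= J)%VS.
Proof.
pose P := [pred A | (A \in C) && (supp A <= J)%VS].
have P0 : P 0.
  by rewrite /= mem0v; apply/supp_subP => j; rewrite col0 mem0v.
have PD A B : P A -> P B -> P (A + B).
  move=> /andP[AC /supp_subP AJ] /andP[BC /supp_subP BJ] /=.
  rewrite memvD //=; apply/supp_subP => j.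
  by rewrite (_ : col j _ = col j A + col j B) ?memvD //; apply/colP => i; rewrite !mxE.
have PZ a A : P A -> P (a *: A).
  move=> /andP[AC /supp_subP AJ] /=.
  rewrite memvZ //=; apply/supp_subP => j.
  by rewrite (_ : col j _ = a *: col j A) ?memvZ //; apply/colP => i; rewrite !mxE.
apply/idP/idP => [|PM]; last first.
  by apply: memv_span; rewrite mem_enum inE.
rewrite /shorten; set X := enum _ => /(@coord_span _ _ _ (in_tuple X)) ->.
rewrite -[_ && _]/(P _); elim/big_ind: _ => // i _; apply: PZ.
by have := mem_nth 0 (ltn_ord i); rewrite mem_enum inE.
Qed.

Lemma shorten_sub C J : (shorten C J <= C)%VS.
Proof. by apply/subvP => M; rewrite mem_shorten => /andP[]. Qed.

(* The subtraction is not truncated, by shorten_sub. *)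
Definition rho C J : nat := (\dim C - \dim (shorten C (perp J)))%N.

(* Number of r-dimensional subcodes of C with support W. *)
Definition supp_distr C (r : nat) W : nat :=
  #|[set D : {vspace 'M[F]_(n, m)} |
      [&& (D <= C)%VS, \dim D == r & Supp D == W]]|.

(* The family (A^(0), ..., A^(k)) with k = \dim C.  Its index range, hence k,
   is part of the data: for C = 0 the family contains no A^(1). *)
Definition supp_distr_family C : seq {ffun {vspace 'cV[F]_n} -> nat} :=
  [seq [ffun W => supp_distr C r W] | r <- iota 0 (\dim C).+1].

(* (q,m)-polymatroids in the sense of Shiromoto: integer-valued, q = #|F|. *)
Definition qm_polymatroid_axiom (f : {ffun {vspace 'cV[F]_n} -> nat}) : bool :=
  [&& [forall J, (f J <= m * \dim J)%N],
      [forall J, forall K, (J <= K)%VS ==> (f J <= f K)%N]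
    & [forall J, forall K,
        (f (J + K)%VS + f (J :&: K)%VS <= f J + f K)%N]].

Record qm_polymatroid := QmPolymatroid {
  qm_rank :> {ffun {vspace 'cV[F]_n} -> nat};
  _ : qm_polymatroid_axiom qm_rank }.

HB.instance Definition _ := [isSub for qm_rank].
HB.instance Definition _ := [Equality of qm_polymatroid by <:].

Lemma perpS J K : (J <= K)%VS -> (perp K <= perp J)%VS.
Proof.
move=> /subvP sJK; apply/subvP => u /mem_perpP uK.
by apply/mem_perpP => v /sJK/uK.
Qed.

Lemma shortenS C J K : (J <= K)%VS -> (shorten C J <= shorten C K)%VS.
Proof.
move=> sJK; apply/subvP => M; rewrite !mem_shorten => /andP[-> /=].
by move/subv_trans; apply.
Qed.

Lemma rho_bound C J : (rho C J <= m * \dim J)%N.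
Proof.
pose B := \matrix_(i < \dim J, a < n) (vbasis J)`_i a 0.
pose f := linfun (mulmx B : 'M[F]_(n, m) -> 'M[F]_(\dim J, m)).
have fE M i j : f M i j = dot (col j M) (vbasis J)`_i.
  by rewrite lfunE mxE; apply: eq_bigr => a _; rewrite !mxE mulrC.
have CE : shorten C (perp J) = (C :&: lker f)%VS.
  apply/vspaceP => M; rewrite mem_shorten memv_cap; congr (_ && _).
  rewrite memv_ker; apply/supp_subP/eqP => [sM | fM0 j].
    apply/matrixP => i j; rewrite fE mxE; apply: (mem_perpP _ _ (sM j)).
    by apply: vbasis_mem; rewrite mem_nth ?size_tuple.
  apply/mem_perpP => v /coord_vbasis ->.
  rewrite linear_sumr big1 // => i _.
  by rewrite linearZr_LR /= -fE fM0 mxE mulr0.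
rewrite /rho CE leq_subLR -(limg_ker_dim f C) leq_add2l mulnC.
by rewrite (leq_trans (dimvS (subvf _))) // dimvf.
Qed.

Lemma rho_mono C J K : (J <= K)%VS -> (rho C J <= rho C K)%N.
Proof. by move=> sJK; rewrite leq_sub2l // dimvS // shortenS // perpS. Qed.

Lemma rho_submod C J K :
  (rho C (J + K)%VS + rho C (J :&: K)%VS <= rho C J + rho C K)%N.
Proof.
rewrite /rho; set a := shorten C (perp J); set b := shorten C (perp K).
set c := shorten _ _; set d := shorten _ _.
have [aC bC] : (\dim a <= \dim C)%N /\ (\dim b <= \dim C)%N.
  by rewrite !dimvS ?shorten_sub.
have [cC dC] : (\dim c <= \dim C)%N /\ (\dim d <= \dim C)%N.
  by rewrite !dimvS ?shorten_sub.
have le_ab_c : (\dim (a :&: b)%VS <= \dim c)%N.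
  apply/dimvS/subvP => M; rewrite memv_cap !mem_shorten.
  case/andP=> /andP[-> /supp_subP MJ] /andP[_ /supp_subP MK] /=.
  apply/supp_subP => j; apply/mem_perpP => _ /memv_addP[u uJ [v vK ->]].
  by rewrite linearDr /= (mem_perpP _ _ (MJ j)) // (mem_perpP _ _ (MK j)) // addr0.
have le_ab_d : (\dim (a + b)%VS <= \dim d)%N.
  by rewrite dimvS // subv_add !shortenS // perpS // (capvSl, capvSr).
have := dimv_sum_cap a b.
lia.
Qed.

Lemma rho_qm_polymatroid C : qm_polymatroid_axiom [ffun J => rho C J].
Proof.
apply/and3P; split; apply/forallP => J; first by rewrite ffunE rho_bound.
  by apply/forallP => K; apply/implyP => /rho_mono; rewrite !ffunE.
by apply/forallP => K; rewrite !ffunE rho_submod.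
Qed.

Definition code_polymatroid C : qm_polymatroid :=
  QmPolymatroid (rho_qm_polymatroid C).

Definition moebius K J : rat :=
  if (K <= J)%VS then
    (-1) ^+ (\dim J - \dim K) * #|F|%:R ^+ 'C(\dim J - \dim K, 2)
  else 0.

End RankMetricCode.

Definition gauss_coef (q : nat) (a b : int) : rat :=
  match b with
  | Posz c => \prod_(i < c)
      (((q%:R : rat) ^ (a - i%:Z) - 1) / ((q%:R : rat) ^ (c%:Z - i%:Z) - 1))
  | Negz _ => 0
  end.

Definition log_base (R : realType) (b x : R) : R := ln x / ln b.

(* Main.v *)
(* Both directions rest on the identity
     \sum_(W <= J) A^(r)(W) = [dim C(J) choose r]_q,
   since a subcode of C has support inside J iff it lies in C(J), together with
   rho_C(E) - rho_C(J^perp) = dim C(J).  Part (1) is its Moebius inversion;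
   for r = 1 it reads 1 + (q-1) \sum_(W <= J) A^(1)(W) = q^(dim C(J)), which is
   part (2).
   The Gaussian count of subspaces and the orthogonality of the Moebius function
   both follow from one recursion: given a hyperplane H of W and K <= H, exactly
   q^(dim H - dim K) subspaces J <= W not inside H satisfy J :&: H = K. *)
Require Import Defs.
From mathcomp Require Import all_boot all_order all_algebra.
From mathcomp Require Import finfield ring zify.
From mathcomp Require Import reals exp.

Set Implicit Arguments.
Unset Strict Implicit.
Unset Printing Implicit Defensive.

Import Order.TTheory GRing.Theory Num.Theory.
Local Open Scope ring_scope.

(** * Subspaces relative to a hyperplane *)

Section HyperplaneCounting.
Variables (F : finFieldType) (T : finType) (cvT : Vector F T).
(** A vector space on a finite carrier, so that vectors can be counted; it is instantiated both at
    columns and at matrices. *)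
Let vT := Vector.Pack cvT.
Implicit Types (H J K L U V W : {vspace vT}).
Local Notation q := #|F|.

Lemma card_vspaceD U H :
  #|[pred v in U | v \notin H]| = (q ^ \dim U - q ^ \dim (U :&: H))%N.
Proof.
rewrite -!card_vspace -(cardID (mem H) (mem U)).
have -> : #|[predI U & H]| = #|(U :&: H)%VS|.
  by apply: eq_card => v; rewrite !inE (@memv_cap _ vT).
by rewrite addKn; apply: eq_card => v; rewrite !inE andbC.
Qed.

Lemma capv_vline_notin H (v : vT) : v \notin H -> (H :&: <[v]>)%VS = 0%VS.
Proof.
move=> vH; apply/eqP; rewrite -subv0; apply/subvP => _ /memv_capP[/[swap]/vlineP[a ->]].
by rewrite memv0 rpredZeq (negPf vH) orbF => /eqP->; rewrite scale0r.
Qed.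

Lemma hyperplane_exists L W : (L <= W)%VS -> L != W ->
  exists H, [/\ (L <= H)%VS, (H <= W)%VS & \dim W = (\dim H).+1].
Proof.
move=> sLW neLW; have /subvPn[v vW vL] : ~~ (W <= L)%VS.
  by apply: contra neLW => sWL; rewrite eqEsubv sLW sWL.
(* [U] is a complement of [L + <[v]>] in [W], so [L + U] misses exactly the direction [v]. *)
pose L1 := (L + <[v]>)%VS; pose U := (W :\: L1)%VS.
have sL1W : (L1 <= W)%VS by rewrite subv_add sLW -memvE.
have dW : (\dim L1 + \dim U)%N = \dim W.
  by rewrite -(dimv_cap_compl W L1) (capv_idPr sL1W).
have v0 : v != 0 by apply: contraNneq vL => ->; rewrite mem0v.
have dL1 : (\dim L).+1 = \dim L1.
  by rewrite /L1 dimv_disjoint_sum ?dim_vline ?v0 ?addn1 ?capv_vline_notin.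
exists (L + U)%VS; split; first exact: addvSl.
  by rewrite subv_add sLW diffvSl.
rewrite dimv_disjoint_sum -?addSn ?dL1 ?dW //; apply/eqP.
by rewrite -subv0 -(capv_diff W L1) capvC capvS // addvSl.
Qed.

Section Fiber.
Variables (H W : {vspace vT}).
Hypotheses (sHW : (H <= W)%VS) (dW : \dim W = (\dim H).+1).

(** [J + H] lies strictly above [H] inside [W], hence has the dimension of [W]; the dimension
    formula for sums gives the rest. *)
Lemma dim_cap_hyperplane J : (J <= W)%VS -> ~~ (J <= H)%VS ->
  \dim J = (\dim (J :&: H)).+1.
Proof.
move=> sJW nsJH; have := dimv_sum_cap J H.
have sW : (J + H <= W)%VS by rewrite subv_add sJW.
have ltH : (\dim H < \dim (J + H))%N.
  rewrite (ltn_leqif (dimv_leqif_sup (addvSr J H))).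
  by apply: contra nsJH; apply: subv_trans (addvSl _ _).
have := dimvS sW; lia.
Qed.

(* Each vector of W outside H lies in exactly one space K + <v> of the fiber,
   and each member of the fiber contains q^(k+1) - q^k such vectors. *)
Lemma card_cap_hyperplane_fiber K : (K <= H)%VS ->
  #|[pred J : {vspace vT} | [&& (J <= W)%VS, ~~ (J <= H)%VS & (J :&: H == K)%VS]]|
    = (q ^ (\dim H - \dim K))%N.
Proof.
move=> sKH; set S := [pred J | _].
have vcap (v : vT) : v \notin H -> ((K + <[v]>) :&: H)%VS = K.
  by move=> vH; rewrite -vspace_modl // capvC capv_vline_notin // addv0.
have SP (v : vT) : v \in W -> v \notin H -> (K + <[v]>)%VS \in S.
  move=> vW vH; rewrite inE vcap // eqxx andbT subv_add.
  rewrite (subv_trans sKH sHW) -memvE vW /=.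
  by apply: contra vH => /(subv_trans (addvSr _ _)); rewrite memvE.
have : #|[pred v in W | v \notin H]|
    = (#|S| * (q ^ (\dim K).+1 - q ^ \dim K))%N.
  rewrite -sum1_card.
  rewrite (partition_big (fun v : vT => K + <[v]>)%VS (mem S)) /=; last first.
    by move=> v /andP[]; apply: SP.
  rewrite -sum_nat_const; apply: eq_bigr => J /and3P[sJW nsJH /eqP JH].
  have dJ := dim_cap_hyperplane sJW nsJH.
  rewrite sum1_card -JH -dJ -(card_vspaceD J).
  apply: eq_card => v; rewrite !inE; apply/andP/andP => [[/andP[vW vH] /eqP <-]|[vJ vH]].
    by split=> //; rewrite JH; apply: subvP (addvSr _ _) _ (memv_line _).
  split; first by apply/andP; split=> //; apply: (subvP sJW).
  (* [K + <[v]>] lies in [J], and both have dimension [(\dim K).+1] because neither lies in [H]. *)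
  rewrite JH eqEdim subv_add -{1}JH capvSl -memvE vJ /=.
  have /dim_cap_hyperplane : (K + <[v : vT]> <= W)%VS.
    by rewrite subv_add (subv_trans sKH) // -memvE; apply: subvP sJW _ vJ.
  rewrite vcap // dJ JH => -> //.
  by apply: contra vH => /(subv_trans (addvSr _ _)); rewrite memvE.
rewrite card_vspaceD (capv_idPr sHW).
have q1 : (1 < q)%N := finNzRing_gt1 F.
have qk : (0 < q ^ \dim K * q.-1)%N.
  by rewrite muln_gt0 expn_gt0 -subn1 subn_gt0 q1 ltnW.
have exp1 d : (q ^ d.+1 - q ^ d = q ^ d * q.-1)%N.
  by rewrite expnSr -[X in (_ - X)%N]muln1 -mulnBr subn1.
rewrite dW !exp1 -{1}(subnK (dimvS sKH)) expnD -mulnA => /eqP.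
by rewrite eqn_pmul2r // => /eqP ->.
Qed.

(** The [J] inside [H] give the first term. The others are grouped by [K = J :&: H]: each group has
    [q ^ (\dim H - \dim K)] members, all of dimension [(\dim K).+1]. *)
Lemma sum_dim_hyperplane (R : nmodType) (f : nat -> R) L : (L <= H)%VS ->
  \sum_(J | (L <= J <= W)%VS) f (\dim J) =
  \sum_(K | (L <= K <= H)%VS)
     (f (\dim K) + f (\dim K).+1 *+ (q ^ (\dim H - \dim K))).
Proof.
move=> sLH; rewrite (bigID (fun J => (J <= H)%VS)) big_split /=; congr (_ + _).
  apply: eq_bigl => J; rewrite -andbA; congr (_ && _).
  by case sJH: (J <= H)%VS; rewrite ?andbF // (subv_trans sJH).
rewrite (partition_big (fun J => J :&: H)%VS (fun K => L <= K <= H)%VS) /=;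
  last first.
  by move=> J /andP[/andP[sLJ _] _]; rewrite subv_cap sLJ sLH capvSr.
apply: eq_bigr => K /andP[sLK sKH].
rewrite -(card_cap_hyperplane_fiber sKH) -sumr_const; apply: congr_big => // J.
  rewrite inE; case: (eqVneq _ K) => [JH|]; rewrite ?andbF ?andbT //.
  by rewrite (subv_trans sLK) // -JH capvSl.
by case/andP=> /andP[/andP[_ sJW] nsJH] /eqP JH; rewrite (dim_cap_hyperplane sJW nsJH) JH.
Qed.

End Fiber.

End HyperplaneCounting.

(** * Gaussian coefficients and the q-Pascal rule *)

(** The numerator of the Gaussian coefficient; at [a = r] it is the denominator. *)
Definition gauss_num (q : nat) (a : int) (r : nat) : rat :=
  \prod_(i < r) (q%:R ^ (a - i%:Z) - 1).

Local Arguments gauss_coef : simpl never.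

Lemma gauss_coefE q a (r : nat) :
  gauss_coef q a r = gauss_num q a r / gauss_num q r r.
Proof. by rewrite /gauss_coef prodf_div. Qed.

Lemma gauss_coef0r q a : gauss_coef q a 0%N = 1.
Proof. by rewrite /gauss_coef big_ord0. Qed.

Lemma gauss_numS q a r : gauss_num q a r.+1 = gauss_num q a r * (q%:R ^ (a - r%:Z) - 1).
Proof. by rewrite /gauss_num big_ord_recr. Qed.

Lemma gauss_numSS q a r :
  gauss_num q (1 + a) r.+1 = (q%:R ^ (1 + a) - 1) * gauss_num q a r.
Proof.
rewrite /gauss_num big_ord_recl subr0; congr (_ * _); apply: eq_bigr => i _.
by congr (_ ^ _ - _); rewrite /= /bump; lia.
Qed.

Lemma gauss_num_neq0 q (r : nat) : (1 < q)%N -> gauss_num q r r != 0.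
Proof.
move=> q1; apply/prodf_neq0 => i _; rewrite subzn ?(ltnW (ltn_ord i)) // subr_eq0.
by rewrite -exprnP -natrX (eqr_nat _ _ 1) gtn_eqF // -{1}(expn0 q) ltn_exp2l // subn_gt0.
Qed.

Lemma gauss_num_gt q (d r : nat) : (d < r)%N -> gauss_num q d r = 0.
Proof.
by move=> ltdr; rewrite /gauss_num (bigD1 (Ordinal ltdr)) //= subrr expr0z subrr mul0r.
Qed.

Lemma gauss_coef_pascal q (d r : nat) : (1 < q)%N ->
  gauss_coef q d.+1 r.+1 = gauss_coef q d r.+1 + gauss_coef q d r *+ q ^ (d - r).
Proof.
move=> q1; rewrite !gauss_coefE.
have := gauss_num_neq0 r q1; have := gauss_num_neq0 r.+1 q1.
rewrite !intS !gauss_numSS gauss_numS mulf_eq0 negb_or => /andP[].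
(* All three numerators contain the factor [gauss_num q d r], which vanishes for [d < r]; the
   truncation of [d - r] is then harmless. *)
case: (leqP r d) => [lerd | ltdr]; last first.
  by rewrite (gauss_num_gt q ltdr) !(mul0r, mulr0) mul0rn addr0.
rewrite subzn // -[X in _ = _ + X]mulr_natr natrX -[_ ^ Posz (d - r)]exprnP.
have -> : q%:R ^ (1 + d%:Z) = q%:R ^+ (d - r) * q%:R ^ (1 + r%:Z) :> rat.
  by rewrite -!intS -!exprnP -exprD; congr (_ ^+ _); lia.
by move=> *; field; apply/andP.
Qed.

(** * The number of subspaces of given dimension *)

Section SubspaceCounting.
Variables (F : finFieldType) (T : finType) (cvT : Vector F T).
Let vT := Vector.Pack cvT.
Implicit Types (U V : {vspace vT}).
Local Notation q := #|F|.

(** Induction on [\dim V]: writing the count as a sum of indicators of the dimension, the hyperplane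
    recursion becomes the q-Pascal rule. *)
Lemma card_subspaces_dim V (r : nat) :
  #|[set U : {vspace vT} | (U <= V)%VS && (\dim U == r)]|%:R
    = gauss_coef q (\dim V) r.
Proof.
have -> : #|[set U : {vspace vT} | (U <= V)%VS && (\dim U == r)]|%:R
    = \sum_(U : {vspace vT} | (0 <= U <= V)%VS) (\dim U == r)%:R :> rat.
  rewrite -sum1_card natr_sum (eq_bigl _ _ (fun U => in_set _ U)) big_mkcondr.
  by apply: eq_big => U; rewrite ?sub0v //; case: eqP.
elim: {V}(\dim V) {-2}V r (erefl (\dim V)) => [|d IHd] V r dV.
  have -> : V = 0%VS by apply/eqP; rewrite -dimv_eq0 dV.
  rewrite (big_pred1 0%VS) => [|U]; last by rewrite sub0v subv0.
  rewrite dimv0; case: r => [|r]; first by rewrite gauss_coef0r.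
  by rewrite gauss_coefE gauss_num_gt ?mul0r.
have nV : 0%VS != V by rewrite eq_sym -dimv_eq0 dV.
have [H [sH0 sHV dVH]] := hyperplane_exists (sub0v V) nV.
have dH : \dim H = d by move: dVH; rewrite dV => -[].
rewrite (sum_dim_hyperplane sHV dVH (fun e => (e == r)%:R) sH0).
rewrite dV dH big_split /= IHd //.
case: r => [|r]; first by rewrite !gauss_coef0r big1 ?addr0 // => K _; rewrite mul0rn.
(* Only [K] of dimension [r] contribute to the second sum, so the multiplicity is constantly
   [q ^ (d - r)]. *)
rewrite gauss_coef_pascal ?finNzRing_gt1 // -dH -(IHd H r) // -sumrMnl.
congr (_ + _); apply: eq_bigr => K _.
by rewrite eqSS; case: eqP => [->|_]; rewrite ?mul0rn.
Qed.

End SubspaceCounting.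

(** * Moebius inversion on the subspace lattice *)

Section Moebius.
Variables (F : finFieldType) (n : nat).
Implicit Types (H J K L W : {vspace 'cV[F]_n}).
Local Notation q := #|F|.

(* Relative to a hyperplane H >= L of W, the terms with J = K and with
   J :&: H = K, J != K cancel for every K <= H. *)
Lemma moebius_sum L W : (L <= W)%VS ->
  \sum_(J | (L <= J <= W)%VS) moebius J W = (L == W)%:R.
Proof.
move=> sLW; have [<- | neLW] := eqVneq L W.
  rewrite (big_pred1 L) => [|J]; last by rewrite -eqEsubv eq_sym.
  by rewrite /moebius subvv subnn mulr1.
have [H [sLH sHW dW]] := hyperplane_exists sLW neLW.
pose f d : rat := (-1) ^+ (\dim W - d) * q%:R ^+ 'C(\dim W - d, 2).
rewrite (eq_bigr (fun J => f (\dim J))) => [|J /andP[_ sJW]]; last by rewrite /moebius sJW.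
rewrite (sum_dim_hyperplane sHW dW f sLH) big1 // => K /andP[_ /dimvS leKH].
(* With [e = \dim H - \dim K], the cancellation is ['C(e.+1, 2) = 'C(e, 2) + e] together with the
   opposite signs. *)
rewrite /f dW subSS subSn // binS bin1 exprD exprS -[_ *+ (q ^ _)]mulr_natr natrX.
ring.
Qed.

(** After exchanging the sums, the coefficient of [a L] is the sum of [moebius J W] over
    [L <= J <= W], which is 1 for [L = W] and 0 otherwise. *)
Lemma moebius_inversion (a b : {vspace 'cV[F]_n} -> rat) :
  (forall J, b J = \sum_(L | (L <= J)%VS) a L) ->
  forall W, a W = \sum_(J | (J <= W)%VS) moebius J W * b J.
Proof.
move=> ab W; under eq_bigr => J _ do rewrite ab mulr_sumr.
rewrite (exchange_big_dep (fun L => L <= W)%VS) /=; last first.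
  by move=> J L sJW sLJ; apply: subv_trans sJW.
rewrite (bigD1 W) ?subvv //= [X in _ + X]big1 ?addr0 => [|L /andP[sLW neLW]]; rewrite -mulr_suml.
  rewrite (eq_bigl _ _ (fun J => andbC _ _)) moebius_sum ?subvv //.
  by rewrite eqxx mul1r.
by rewrite (eq_bigl _ _ (fun J => andbC _ _)) moebius_sum // (negPf neLW) mul0r.
Qed.

End Moebius.

(** * Double orthogonal complement *)

Section Perp.
Variables (F : fieldType) (n : nat).
Implicit Types (u v : 'cV[F]_n) (J : {vspace 'cV[F]_n}).

Lemma dotC u v : dot u v = dot v u.
Proof. by apply: eq_bigr => i _; rewrite mulrC. Qed.

Lemma dot_delta u i : dot u (delta_mx i 0) = u i 0.
Proof.
rewrite /dot (bigD1 i) //= mxE !eqxx mulr1 big1 ?addr0 // => j ji.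
by rewrite mxE (negPf ji) mulr0.
Qed.

Lemma perp_fullv : perp fullv = 0%VS :> {vspace 'cV[F]_n}.
Proof.
apply/eqP; rewrite -subv0; apply/subvP => u /mem_perpP u0.
rewrite memv0; apply/eqP/colP => i; rewrite -dot_delta mxE.
by apply: u0; apply: memvf.
Qed.

(* A vector x outside J is separated from J by a coordinate of the projection
   along J, and that linear form is the dot product with some w. *)
Lemma perpK : involutive (@perp F n).
Proof.
move=> J; apply/eqP; rewrite eqEsubv; apply/andP; split; apply/subvP => x xJ; last first.
  by apply/mem_perpP => v /mem_perpP vJ; rewrite dotC; apply: vJ.
pose p v := v - projv J v.
suff: p x = 0 by move/eqP; rewrite subr_eq0 => /eqP->; apply: memv_proj.
apply/colP => i; rewrite [RHS]mxE.
pose w : 'cV[F]_n := \col_a p (delta_mx a 0) i 0.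
have pE v : p v i 0 = dot v w.
  rewrite {1}(matrix_sum_delta v) /p linear_sum /= -sumrB summxE.
  apply: eq_bigr => a _; rewrite big_ord1 linearZ /= -scalerBr !mxE.
  by rewrite (_ : (ord0 : 'I_1) = 0).
rewrite pE; move/mem_perpP: xJ; apply; apply/mem_perpP => v vJ.
by rewrite dotC -pE /p projv_id // subrr mxE.
Qed.

End Perp.

(** * Support distributions and the rank function *)

Section Codes.
Variables (F : finFieldType) (n m : nat).
Implicit Types (C D : {vspace 'M[F]_(n, m)}) (J W : {vspace 'cV[F]_n}).
Local Notation q := #|F|.
Local Notation shorten := Defs.shorten. (* [path.shorten] shadows it *)

Lemma Supp_sub D J :
  (Supp D <= J)%VS = [forall M : 'M[F]_(n, m), (M \in D) ==> (supp M <= J)%VS].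
Proof.
apply/subv_sumP/forall_inP => // sD M MD; exact: sD.
Qed.

Lemma sub_shorten C D J : (D <= shorten C J)%VS = (D <= C)%VS && (Supp D <= J)%VS.
Proof.
rewrite Supp_sub; apply/subvP/andP => [sD | [/subvP sDC /forall_inP sDJ] M MD].
  split; first by apply/subvP => M /sD; rewrite mem_shorten => /andP[].
  by apply/forall_inP => M /sD; rewrite mem_shorten => /andP[].
by rewrite mem_shorten sDC ?sDJ.
Qed.

Lemma sum_supp_distr C (r : nat) J :
  (\sum_(W | (W <= J)%VS) supp_distr C r W)%N
    = #|[set D : {vspace 'M[F]_(n, m)} | (D <= shorten C J)%VS && (\dim D == r)]|.
Proof.
rewrite -[RHS]sum1_card (partition_big (@Supp F n m) (fun W => W <= J)%VS) /=; last first.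
  by move=> D; rewrite inE sub_shorten => /andP[/andP[]].
apply: eq_bigr => W sWJ; rewrite /supp_distr -sum1_card; apply: eq_bigl => D.
rewrite !inE sub_shorten; case: (eqVneq (Supp D) W) => [->|]; rewrite ?andbF //.
by rewrite sWJ !andbT.
Qed.

Lemma sum_supp_distr_gauss C (r : nat) J :
  \sum_(W | (W <= J)%VS) (supp_distr C r W)%:R = gauss_coef q (\dim (shorten C J)) r.
Proof. by rewrite -natr_sum sum_supp_distr card_subspaces_dim. Qed.

Lemma shorten0 C : shorten C 0 = 0%VS.
Proof.
apply/eqP; rewrite -subv0; apply/subvP => M; rewrite mem_shorten => /andP[_ /supp_subP M0].
rewrite memv0; apply/eqP/matrixP => i j; rewrite mxE.
by have := M0 j; rewrite memv0 => /eqP/colP/(_ i); rewrite !mxE.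
Qed.

Lemma rho_fullv C : rho C fullv = \dim C.
Proof. by rewrite /rho perp_fullv shorten0 dimv0 subn0. Qed.

Lemma rho_fullvB C J :
  (rho C fullv)%:Z - (rho C (perp J))%:Z = \dim (shorten C J).
Proof.
rewrite rho_fullv /rho perpK; have := dimvS (shorten_sub C J); lia.
Qed.

Lemma supp_distrE C (r : nat) W :
  (supp_distr C r W)%:R =
  \sum_(J | (J <= W)%VS)
    moebius J W * gauss_coef q ((rho C fullv)%:Z - (rho C (perp J))%:Z) r%:Z.
Proof.
apply: (moebius_inversion (a := fun W => (supp_distr C r W)%:R)) => J.
by rewrite rho_fullvB sum_supp_distr_gauss.
Qed.

(** For [r = 1] the Gaussian coefficient is [(q^d - 1) / (q - 1)] with [d = \dim (shorten C J)]. *)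
Lemma card_shorten C J :
  (1 + (q - 1) * \sum_(W | (W <= J)%VS) supp_distr C 1 W = q ^ \dim (shorten C J))%N.
Proof.
have q1 := finNzRing_gt1 F.
have q10 : (q%:R - 1 : rat) != 0 by rewrite subr_eq0 (eqr_nat _ _ 1) gtn_eqF.
apply/eqP; rewrite -(eqr_nat rat) natrD natrM natr_sum sum_supp_distr_gauss.
rewrite natrB ?(ltnW q1) // /gauss_coef big_ord1 !subr0 natrX.
by rewrite [_ ^ 1]expr1z mulrC divfK // addrC subrK.
Qed.

Lemma dim_supp_distr C C' :
  (forall W, supp_distr C 1 W = supp_distr C' 1 W) ->
  forall J, \dim (shorten C J) = \dim (shorten C' J).
Proof.
move=> eqA J; apply/eqP; rewrite -(eqn_exp2l _ _ (finNzRing_gt1 F)) -!card_shorten.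
by under eq_bigr do rewrite eqA.
Qed.

Lemma shortenf C : shorten C fullv = C.
Proof. by apply/vspaceP => M; rewrite mem_shorten subvf andbT. Qed.

Lemma rho_supp_distr C C' :
  (forall W, supp_distr C 1 W = supp_distr C' 1 W) ->
  forall J, rho C J = rho C' J.
Proof.
move=> /dim_supp_distr eqd J; rewrite /rho eqd.
(* The remaining term [\dim C] is the case [J = fullv]. *)
by have := eqd fullv; rewrite !shortenf => ->.
Qed.

Lemma supp_distr_family_rho C C' :
  (forall J, rho C J = rho C' J) -> supp_distr_family C = supp_distr_family C'.
Proof.
(* The index range is determined as well, since [\dim C] is the rank of the full space. *)
move=> eqrho; rewrite /supp_distr_family -!rho_fullv eqrho.
apply: eq_map => r; apply/ffunP => W; rewrite !ffunE.
apply/eqP; rewrite -(eqr_nat rat) !supp_distrE; apply/eqP.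
by apply: eq_bigr => J _; rewrite !eqrho.
Qed.

Lemma rho_supp_distr_family C C' :
  supp_distr_family C = supp_distr_family C' -> forall J, rho C J = rho C' J.
Proof.
(* The length of the family is [(\dim C).+1]. *)
move=> eqA; have dC : \dim C = \dim C'.
  by have := congr1 size eqA; rewrite !size_map !size_iota => -[].
(* In dimension 0 the family has no entry of index 1, but then both codes are zero. Otherwise entry
   1 exists and the default of [nth] is never reached. *)
case dC0 : (\dim C) => [|k].
  have [-> ->] : C = 0%VS /\ C' = 0%VS by split; apply/eqP; rewrite -dimv_eq0 -?dC dC0.
  by [].
apply: rho_supp_distr => W.
have := congr1 (fun s => nth [ffun=> 0%N] s 1 W) eqA.
by rewrite /supp_distr_family -dC dC0 /= !ffunE.
Qed.

Lemma rho_log (R : realType) C J :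
  (rho C J)%:R =
  (\dim C)%:R - log_base (q%:R : R)
    (1 + (q%:R - 1) * \sum_(W | (W <= perp J)%VS) (supp_distr C 1 W)%:R).
Proof.
have q1 := finNzRing_gt1 F; have lnq : ln (q%:R : R) != 0.
  by rewrite gt_eqF // ln_gt0 // ltr1n.
(* The argument of the logarithm is gathered into one natural number, which equals
   [q ^ \dim (shorten C (perp J))]. *)
rewrite -natr_sum -[1]/(1%:R) -natrB ?(ltnW q1) // -natrM -natrD card_shorten.
rewrite natrX /log_base lnXn ?ltr0n ?(ltnW q1) // -[ln _ *+ _]mulr_natl mulfK //.
by rewrite /rho natrB // dimvS // shorten_sub.
Qed.

End Codes.


Theorem theorem3p21 (R : realType) (F : finFieldType) (n m k : nat)
    (C : {vspace 'M[F]_(n, m)}) (dimC : \dim C = k) :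
  [/\ (* (1) *)
      (forall (r : nat) (W : {vspace 'cV[F]_n}), (r <= k)%N ->
         (supp_distr C r W)%:R =
         \sum_(J : {vspace 'cV[F]_n} | (J <= W)%VS)
           moebius J W *
           gauss_coef #|F|
             ((rho C fullv)%:Z - (rho C (perp J))%:Z) r%:Z),
      (forall C' : {vspace 'M[F]_(n, m)},
         (forall J, rho C J = rho C' J) ->
         supp_distr_family C = supp_distr_family C'),
      (* (2) *)
      (forall J : {vspace 'cV[F]_n},
         (rho C J)%:R =
         (\dim C)%:R -
         log_base (#|F|%:R : R)
           (1 + (#|F|%:R - 1) *
                \sum_(W : {vspace 'cV[F]_n} | (W <= perp J)%VS)
                  (supp_distr C 1 W)%:R)),
      (forall C' : {vspace 'M[F]_(n, m)},
         (forall W, supp_distr C 1 W = supp_distr C' 1 W) ->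
         forall J, rho C J = rho C' J)
    & (* equivalence of the two invariants *)
      (forall C' : {vspace 'M[F]_(n, m)},
         code_polymatroid C = code_polymatroid C' <->
         supp_distr_family C = supp_distr_family C')].
Proof.
split.
- by move=> r W _; apply: supp_distrE.
- exact: supp_distr_family_rho.
- exact: rho_log.
- exact: rho_supp_distr.
- move=> C'; split=> [eqP | /rho_supp_distr_family eqrho].
    apply: supp_distr_family_rho => J.
    by have /ffunP/(_ J) := congr1 (@qm_rank F n m) eqP; rewrite !ffunE.
  (* Polymatroids with the same rank function are equal, the axiom being a boolean. *)
  by apply: val_inj; apply/ffunP => J; rewrite !ffunE.
Qed.
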